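(* Let $P$ be a poset and let $f\colon P\to P$ be an order-preserving map. If $X\subseteq P$ is downward directed and closed under $f$ (i.e. $f(x)\in X$ for all $x\in X$), and $f$ is decreasing on $X$ (i.e. $f(x)\le x$ for all $x\in X$), then $f^\sigma(\bigwedge X)=\bigwedge X$ in the canonical extension $P^\sigma$ of $P$ (where $\bigwedge X$ is the meet taken in $P^\sigma$).
   Context: A completion of a poset $P$ is a pair $\langle e,C\rangle$ where $C$ is a complete lattice and $e$ is an order embedding of $P$ into $C$ preserving all existing finite meets and joins of $P$. An element of $C$ is open (resp. closed) if it equals $\bigvee e(X)$ (resp. $\bigwedge e(X)$), taken in $C$, for some subset $X$ of $P$; $O$ and $K$ denote the sets of open and closed elements. The completion is dense if every element of $C$ is both a join of closed elements and a meet of open elements; it is compact if for any $A\subseteq K$ and $B\subseteq O$, $\bigwedge A\le\bigvee B$ if and only if there are finite subsets $A_0$ of $A$ and $B_0$ of $B$ with $\bigwedge A_0\le\bigvee B_0$. A dense and compact completion is called a canonical extension; every poset $P$ has one, unique up to a lattice isomorphism commuting with the embeddings, and it is denoted $P^\sigma$, with $P$ identified with its image. For $f\colon P\to P$, the map $f^\sigma\colon P^\sigma\to P^\sigma$ is $$f^\sigma(x)=\bigvee\bigl\{\bigwedge\{f(a)\mid a\in P,\ p\le a\le q\}\mid p\in K,\ q\in O,\ p\le x\le q\bigr\}.$$ As usual, a set is downward directed if it is nonempty and any two of its elements have a common lower bound in it. *)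

(* Defs.v *)
From HB Require Import structures.
From mathcomp Require Import all_boot all_order.
From mathcomp Require Import boolp classical_sets cardinality.

Set Implicit Arguments.
Unset Strict Implicit.
Unset Printing Implicit Defensive.

Import Order.TTheory.
Local Open Scope classical_set_scope.
Local Open Scope order_scope.

(* Complete lattices: the bounds of all subsets, including set0, are required,
   so [bigmeet set0] is the top and [bigjoin set0] the bottom element. *)
HB.mixin Record Lattice_isComplete (d : Order.disp_t) T of Order.Lattice d T := {
  bigjoin : set T -> T;
  bigmeet : set T -> T;
  bigjoin_supremum : forall A : set T, supremums A (bigjoin A);
  bigmeet_infimum : forall A : set T, infimums A (bigmeet A)
}.

#[short(type="completeLatticeType")]
HB.structure Definition CompleteLattice (d : Order.disp_t) :=
  { T of Order.Lattice d T & Lattice_isComplete d T }.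

Section CanonicalExtension.
Context {d d' : Order.disp_t} {P : porderType d} {C : completeLatticeType d'}.
Variable e : P -> C.

(* The finite sets S below may be empty: a greatest (least) element of P, if
   there is one, is an existing finite meet (join) and has to be preserved. *)
Definition completion : Prop :=
  [/\ {mono e : x y / x <= y},
      forall (S : set P) (m : P),
        finite_set S -> infimums S m -> e m = bigmeet (e @` S)
    & forall (S : set P) (j : P),
        finite_set S -> supremums S j -> e j = bigjoin (e @` S)].

Definition open_elements : set C := [set bigjoin (e @` X) | X in [set: set P]].

Definition closed_elements : set C := [set bigmeet (e @` X) | X in [set: set P]].

Definition dense_completion : Prop :=
  forall c : C,
    (exists2 A : set C, A `<=` closed_elements & c = bigjoin A) /\
    (exists2 B : set C, B `<=` open_elements & c = bigmeet B).

Definition compact_completion : Prop :=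
  forall A B : set C, A `<=` closed_elements -> B `<=` open_elements ->
    bigmeet A <= bigjoin B <->
    exists A0 B0 : set C,
      [/\ finite_set A0 /\ A0 `<=` A,
          finite_set B0 /\ B0 `<=` B
        & bigmeet A0 <= bigjoin B0].

Definition canonical_extension : Prop :=
  [/\ completion, dense_completion & compact_completion].

Definition sigma_extension (f : P -> P) (x : C) : C :=
  bigjoin [set c | exists p q : C,
    [/\ closed_elements p, open_elements q, p <= x <= q
      & c = bigmeet [set e (f a) | a in [set a | p <= e a <= q]]]].

End CanonicalExtension.

Definition downward_directed {d : Order.disp_t} {P : porderType d} (X : set P) :
    Prop :=
  X !=set0 /\
  forall x y, X x -> X y -> exists z, [/\ X z, z <= x & z <= y].

(* Main.v *)
Require Import Defs.
From mathcomp Require Import all_boot all_order.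
From mathcomp Require Import boolp classical_sets cardinality.

Import Order.TTheory.
Local Open Scope classical_set_scope.
Local Open Scope order_scope.

(** Compactness turns [bigmeet (e @` X) <= q], for an open [q], into
    [e z <= q] for a single [z] in the directed set [X].  With [q = e a] and
    the fact that [X] is closed under [f], every [e (f a)] with
    [bigmeet (e @` X) <= e a] lies above [bigmeet (e @` X)].  With an arbitrary
    [q] above [bigmeet (e @` X)], the elements of [X] below [z] all lie in the
    intervals occurring in [sigma_extension], and [f] decreases them. *)

Section CompleteLatticeTheory.
Context {d : Order.disp_t} {C : completeLatticeType d}.
Implicit Types (A : set C) (c : C).

Lemma bigjoin_ub A c : A c -> c <= bigjoin A.
Proof. by case: (bigjoin_supremum A) => + _; apply. Qed.

Lemma bigjoin_le A c : (forall a, A a -> a <= c) -> bigjoin A <= c.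
Proof. by case: (bigjoin_supremum A) => _ + Ac; apply. Qed.

Lemma bigmeet_lb A c : A c -> bigmeet A <= c.
Proof. by case: (bigmeet_infimum A) => + _; apply. Qed.

Lemma bigmeet_ge A c : (forall a, A a -> c <= a) -> c <= bigmeet A.
Proof. by case: (bigmeet_infimum A) => _ + Ac; apply. Qed.

Lemma bigjoin1 c : bigjoin [set c] = c.
Proof.
by apply/le_anti; rewrite bigjoin_ub// andbT; apply: bigjoin_le => _ ->.
Qed.

Lemma bigmeet1 c : bigmeet [set c] = c.
Proof. by apply/le_anti; rewrite bigmeet_lb//=; apply: bigmeet_ge => _ ->. Qed.

End CompleteLatticeTheory.

Section Embedding.
Context {d d' : Order.disp_t} {P : porderType d} {C : completeLatticeType d'}.
Variable e : P -> C.

Lemma open_elements_image a : open_elements e (e a).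
Proof. by exists [set a]; rewrite ?image_set1 ?bigjoin1. Qed.

Lemma closed_elements_image a : closed_elements e (e a).
Proof. by exists [set a]; rewrite ?image_set1 ?bigmeet1. Qed.

(** Induction on an enumeration of [A]: directedness merges a bound for the tail with a preimage of
    the head. For empty [A], the nonemptiness of [X] supplies [z]. *)
Lemma directed_finite_lb (X : set P) (A : set C) :
  {homo e : x y / x <= y} -> downward_directed X ->
  finite_set A -> A `<=` e @` X -> exists2 z, X z & e z <= bigmeet A.
Proof.
move=> he [[x0 Xx0] dirX] /finite_seqP[s ->].
suff lb : [set` s] `<=` e @` X ->
    exists2 z, X z & forall c, c \in s -> e z <= c.
  by move=> /lb[z Xz zs]; exists z => //; exact: bigmeet_ge.
elim: s => [|c s IHs] sX; first by exists x0.
have [z Xz zs] : exists2 z, X z & forall c', c' \in s -> e z <= c'.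
  by apply: IHs => c' sc'; apply: sX; rewrite /= inE; apply/orP; right.
have [x Xx xc] : (e @` X) c by apply: sX; rewrite /= inE eqxx.
have [w [Xw wx wz]] := dirX _ _ Xx Xz.
exists w => // c'; rewrite inE => /orP[/eqP->|/zs]; first by rewrite -xc he.
by apply: le_trans; exact: he.
Qed.

(** Compactness is applied to the image of [X], whose members are closed, and to the singleton of
    [q]; a lower bound in [X] then replaces the finite meet. *)
Lemma compact_directed (X : set P) (q : C) :
  {homo e : x y / x <= y} -> compact_completion e -> downward_directed X ->
  open_elements e q -> bigmeet (e @` X) <= q -> exists2 z, X z & e z <= q.
Proof.
move=> he compe dirX oq Xq.
have XK : e @` X `<=` closed_elements e.
  by move=> _ [x _ <-]; exact: closed_elements_image.
have qO : [set q] `<=` open_elements e by move=> _ ->.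
have := (compe _ _ XK qO).1; rewrite bigjoin1 => /(_ Xq).
move=> [A0 [B0 [[finA AX] [_ Bq] AB]]].
have [z Xz zA] := directed_finite_lb X A0 he dirX finA AX.
exists z => //; apply/(le_trans zA)/(le_trans AB).
(* [B0] is empty or the singleton of [q]; its join is at most [q] in both cases. *)
by apply: bigjoin_le => b /Bq ->.
Qed.

End Embedding.

Theorem lemma4p9 (d d' : Order.disp_t) (P : porderType d)
    (C : completeLatticeType d') (e : P -> C) (he : canonical_extension e)
    (f : P -> P) (hf : {homo f : x y / x <= y})
    (X : set P) (hX : downward_directed X)
    (hXf : forall x : P, X x -> X (f x))
    (hfX : forall x : P, X x -> f x <= x) :
  sigma_extension e f (bigmeet (e @` X)) = bigmeet (e @` X).
Proof.
have [[e_mono _ _] _ compe] := he.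
have e_homo : {homo e : x y / x <= y} by move=> x y; rewrite e_mono.
have eX_lb x : X x -> bigmeet (e @` X) <= e x.
  by move=> Xx; apply: bigmeet_lb; exists x.
have [[x0 Xx0] dirX] := hX.
apply/le_anti/andP; split.
- apply: bigjoin_le => _ [p [q [_ oq /andP[pX Xq] ->]]].
  have [z Xz zq] := compact_directed e X q e_homo compe hX oq Xq.
  apply: bigmeet_ge => _ [x Xx <-].
  (* [x] itself may fail to lie below [q]; passing to [w], below both [x] and [z], puts [e w]
     between [p] and [q], and [f w <= w <= x]. *)
  have [w [Xw wx wz]] := dirX _ _ Xx Xz.
  apply: (@le_trans _ _ (e (f w))).
    apply: bigmeet_lb; exists w => //=.
    by rewrite (le_trans pX (eX_lb _ Xw)) (le_trans _ zq)// e_homo.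
  by rewrite e_mono (le_trans (hfX _ Xw)).
(* A single term of the join suffices: the lower endpoint is the meet of [X], which is closed, and
   the upper one is the image of any element of [X]. *)
- apply: (@le_trans _ _ (bigmeet [set e (f a) |
      a in [set a | bigmeet (e @` X) <= e a <= e x0]])).
    apply: bigmeet_ge => _ [a /= /andP[Xa _] <-].
    have [z Xz] := compact_directed e X (e a) e_homo compe hX
      (open_elements_image e a) Xa.
    rewrite e_mono => za; apply: (le_trans (eX_lb _ (hXf _ Xz))).
    by rewrite e_mono hf.
  apply: bigjoin_ub; exists (bigmeet (e @` X)), (e x0); split => //.
  + by exists X.
  + exact: open_elements_image.
  + by rewrite lexx eX_lb.
Qed.
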